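(* The line graph of any (multi)graph of maximum degree $3$ with at least $23$ edges has diameter greater than $3$. That is, $h_3(3)=23$.
   Context: Graphs and multigraphs are finite; multigraphs may have parallel edges and loops (a loop contributes $2$ to the degree of its vertex). The line graph $L(G)$ of a (multi)graph $G$ has the edges of $G$ as its vertices, two distinct edges being adjacent if they share an endpoint. The diameter of a graph is the maximum distance between two of its vertices (infinite if the graph is disconnected). For integers $t,\Delta\ge1$, $h_t(\Delta)$ is defined by the requirement that $h_t(\Delta)-1$ is the largest number of edges in a (simple) graph of maximum degree at most $\Delta$ whose line graph has diameter at most $t$. *)

(* Defs.v *)
From mathcomp Require Import all_boot.

Set Implicit Arguments.
Unset Strict Implicit.
Unset Printing Implicit Defensive.

(* Finite multigraphs: [ends e] is the set of endpoints of [e], so a loop is an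
   edge with a one-element set of endpoints, and parallel edges are edges with
   the same set of endpoints. *)
Record mgraph := MGraph {
  vertex : finType;
  edge : finType;
  ends : edge -> {set vertex};
  card_ends : forall e, 0 < #|ends e| <= 2
}.

Definition is_loop (G : mgraph) (e : edge G) : bool := #|ends e| == 1.

Definition degree (G : mgraph) (v : vertex G) : nat :=
  \sum_(e : edge G | v \in ends e) (if is_loop e then 2 else 1).

Definition max_degree (G : mgraph) : nat := \max_(v : vertex G) degree v.

Definition num_edges (G : mgraph) : nat := #|edge G|.

Definition simple (G : mgraph) : Prop :=
  (forall e : edge G, ~~ is_loop e) /\ injective (@ends G).

Definition line_graph (G : mgraph) : rel (edge G) :=
  fun e f => (e != f) && (ends e :&: ends f != set0).

Lemma line_graph_sym (G : mgraph) : symmetric (line_graph (G := G)).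
Proof. by move=> e f; rewrite /line_graph eq_sym setIC. Qed.

Lemma line_graph_irrefl (G : mgraph) : irreflexive (line_graph (G := G)).
Proof. by move=> e; rewrite /line_graph eqxx. Qed.

(* Natural numbers extended with infinity, which is [None]. *)
Definition enat : Type := option nat.

Definition enat_le (d : enat) (n : nat) : bool :=
  if d is Some m then m <= n else false.

Definition enat_gt (d : enat) (n : nat) : bool :=
  if d is Some m then n < m else true.

Definition enat_max (a b : enat) : enat :=
  if (a, b) is (Some m, Some n) then Some (maxn m n) else None.

Section Distance.

Variables (T : finType) (adj : rel T).

Definition has_walk (x y : T) (k : nat) : bool :=
  [exists p : k.-tuple T, path adj x p && (last x p == y)].

Lemma connect_has_walk x y : connect adj x y -> exists k, has_walk x y k.
Proof.
case/connectP=> p adj_p ->; exists (size p).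
by apply/existsP; exists (in_tuple p); rewrite adj_p eqxx.
Qed.

Definition dist (x y : T) : enat :=
  if decP (@idP (connect adj x y)) is left xy
  then Some (ex_minn (connect_has_walk xy)) else None.

Definition diam : enat :=
  \big[enat_max/Some 0]_(x : T) \big[enat_max/Some 0]_(y : T) dist x y.

End Distance.

(* [is_h t D h] states h_t(D) = h: the largest number of edges in a simple graph
   of maximum degree at most D whose line graph has diameter at most t is the
   (natural) number h - 1. *)
Definition admissible (t D : nat) (G : mgraph) : Prop :=
  [/\ simple G, max_degree G <= D & enat_le (diam (line_graph (G := G))) t].

Definition is_h (t D h : nat) : Prop :=
  exists m : nat,
    [/\ h = m.+1,
        exists2 G : mgraph, admissible t D G & num_edges G = m
      & forall G : mgraph, admissible t D G -> num_edges G <= m].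

Lemma is_h_unique t D h h' : is_h t D h -> is_h t D h' -> h = h'.
Proof.
move=> [m [-> [G aG <-] maxG]] [m' [-> [G' aG' <-] maxG']].
by congr _.+1; apply/eqP; rewrite eqn_leq maxG // maxG'.
Qed.

(* Main.v *)
Require Import Defs.
From mathcomp Require Import all_boot zify.

(** Suppose that L(G) has diameter at most 3, where G has maximum degree at most
    3 and at least 23 edges.  Growing the set of edges reached from an edge [e]
    shows that [e] meets at least 4 other edges and that there are at most 29
    edges, so that G is a simple cubic graph (up to isolated vertices) on 16 or
    18 vertices.  Every edge then meets the ball of radius 2 around each edge,
    and counting the edges that leave this ball bounds the number of edges it
    contains.  An exhaustive search shows that this bound excludes cycles of
    length 3 to 6, and a second one that a cubic graph without such cycles
    has more than 18 vertices. *)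

Set Implicit Arguments.
Unset Strict Implicit.
Unset Printing Implicit Defensive.

(** * Exhaustive search over partially known cubic graphs, and its computed results *)

(* A partially known cubic graph is the list of the lists of known neighbours of
   the vertices 0, 1, ... found so far. *)
Definition nbrs (g : seq (seq nat)) i := nth [::] g i.
Definition add_dart g i j := set_nth [::] g i (rcons (nbrs g i) j).
Definition add_edge g i j := add_dart (add_dart g i j) j i.

Lemma nbrs_add_dart g i j x :
  nbrs (add_dart g i j) x = if x == i then rcons (nbrs g i) j else nbrs g x.
Proof. by rewrite /nbrs nth_set_nth. Qed.

(** In the case [j = size g] the edge leads to a new vertex. *)
Lemma size_add_edge g i j :
  i < size g -> j <= size g -> size (add_edge g i j) = maxn j.+1 (size g).
Proof. by move=> lig ljg; rewrite !size_set_nth (maxn_idPr lig). Qed.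

(* Invariant: the missing neighbours of [v] lie in [cs] or are new vertices.
   [bad] recognizes graphs that cannot occur.  The nested [if]s, unlike [&&] and
   [||], are short-circuited by [vm_compute]. *)
Fixpoint search (bad : seq (seq nat) -> bool) fuel v cs g :=
  if fuel is fuel'.+1 then
    if size (nbrs g v) < 3 then
      if cs is w :: cs' then
        if search bad fuel' v cs' g then
          if w \in v :: nbrs g v then true else
          if v \in nbrs g w then false else
          if 2 < size (nbrs g w) then true else
          search bad fuel' v cs' (add_edge g v w)
        else false
      else search bad fuel' v [::] (add_edge g v (size g))
    else if bad g then true else
      let v' := find (fun l => size l < 3) g in
      if v' < size g then search bad fuel' v' (iota 0 (size g)) g else false
  else false.

Definition ball g s := undup (s ++ flatten [seq nbrs g i | i <- s]).
Definition deficit g s := sumn [seq 3 - size (nbrs g i) | i <- s].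
Definition darts g s := sumn [seq count (mem s) (nbrs g i) | i <- s].

(* Let B be the ball of radius 2 around an edge of a cubic graph on [n]
   vertices.  If B meets all edges and d is the number of ordered adjacent pairs
   in B, then counting the edges that leave B from both sides gives
   [3 * n + d = 6 * #|B|].  Here [b2] is the known part of B; each of the at
   most [deficit g b1] other vertices of B adds at least 2 to d, hence the 4. *)
Definition crowded_edge n g u v :=
  if (size (nbrs g u) == 3) && (size (nbrs g v) == 3) then
    let b1 := ball g [:: u; v] in let b2 := ball g b1 in
    6 * size b2 + 4 * deficit g b1 < 3 * n + darts g b2
  else false.
Definition crowded n g :=
  (n < size g) ||
  has (fun u => has (fun v => if u < v then crowded_edge n g u v else false)
                    (nbrs g u)) (iota 0 (size g)).

Definition cycle_graph k := mkseq (fun i => [:: i.+1 %% k; (i + k.-1) %% k]) k.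

(* Extends the path [p], listed from its current end, by up to [m] vertices. *)
Fixpoint cycle_from g m p :=
  if p is x :: p' then
    ((2 < size p) && (last x p' \in nbrs g x)) ||
    (if m is m'.+1 then
       has (fun y => if y \in p then false else cycle_from g m' (y :: p))
           (nbrs g x)
     else false)
  else false.
(** A one-vertex path with up to 5 further vertices covers the cycles of length at most 6; 18 is the
    larger of the two possible orders. *)
Definition cyclic g :=
  (18 < size g) || has (fun v => cycle_from g 5 [:: v]) (iota 0 (size g)).

(** The fuel 400 suffices for the computations below; running out of it yields [false], so it cannot
    produce a false refutation. *)
Definition refuted bad g := search bad 400 0 (iota 0 (size g)) g.

(** The search starts from a single edge: a cubic graph of girth at least 7 has more than 18
    vertices. *)
Lemma refuted_cyclic : refuted cyclic [:: [:: 1]; [:: 0]].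
Proof. by vm_compute. Qed.

Lemma refuted_crowded n k :
  n \in [:: 16; 18] -> k \in [:: 3; 4; 5; 6] ->
  refuted (crowded n) (cycle_graph k).
Proof.
have /allP H : all (fun n => all (fun k => refuted (crowded n) (cycle_graph k))
    [:: 3; 4; 5; 6]) [:: 16; 18] by vm_compute.
by move=> /H/allP; apply.
Qed.

(** * Embeddings of partial graphs and soundness of the search *)

Section Cubic.

Variables (T : finType) (adj : rel T).
Hypothesis adj_sym : symmetric adj.
Hypothesis adj_irr : irreflexive adj.
Definition nb x := [set y | adj x y].
Hypothesis cubic : forall x y, adj x y -> #|nb x| = 3.
(** The multigraph may have isolated vertices; the order of the cubic graph is the size of this
    set. *)
Definition supp := [set x | [exists y, adj x y]].

(** Only recorded adjacencies constrain [f]: a missing entry does not mean a non-edge, and the lists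
    need not be symmetric. *)
Definition embeds (f : nat -> T) g :=
  [/\ forall i j, i < size g -> j < size g -> f i = f j -> i = j,
      forall i, i < size g -> f i \in supp,
      forall i, uniq (nbrs g i)
    & forall i j, j \in nbrs g i ->
        [/\ i < size g, j < size g & adj (f i) (f j)]].

Lemma nb_embeds_card f g i :
  embeds f g -> #|[set x in map f (nbrs g i)]| = size (nbrs g i).
Proof.
move=> [injf _ un bd]; rewrite cardsE (card_uniqP _) ?size_map //.
rewrite map_inj_in_uniq // => x y xi yi; apply: injf.
  by case: (bd _ _ xi).
by case: (bd _ _ yi).
Qed.

Lemma nb_embeds_sub f g i :
  embeds f g -> [set x in map f (nbrs g i)] \subset nb (f i).
Proof.
move=> [_ _ _ bd]; apply/subsetP=> x; rewrite !inE => /mapP[j ji ->].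
by case: (bd _ _ ji).
Qed.

Lemma card_nb x : x \in supp -> #|nb x| = 3.
Proof. by rewrite inE => /existsP[y]; apply: cubic. Qed.

Lemma mem_supp x y : adj x y -> x \in supp.
Proof. by move=> xy; rewrite inE; apply/existsP; exists y. Qed.

(** This serves both for a known vertex [w] and for the new vertex [w = size g], where the condition
    on [f w] says that its image is fresh. *)
Lemma embeds_add_edge f g v w :
  embeds f g -> v < size g -> w <= size g -> w != v ->
  w \notin nbrs g v -> v \notin nbrs g w ->
  (forall i, i < size g -> f i = f w -> i = w) -> adj (f v) (f w) ->
  embeds f (add_edge g v w).
Proof.
move=> [injf sp un bd] lv lw nwv nw nv injw avw.
have szE : size (add_edge g v w) = maxn w.+1 (size g) by apply: size_add_edge.
have ltE i : i < maxn w.+1 (size g) -> i < size g \/ i = w.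
  rewrite leq_max ltnS leq_eqVlt => /orP[/orP[/eqP->|iw]|]; auto.
  by left; apply: leq_trans lw.
have mw : w < maxn w.+1 (size g) by rewrite leq_max leqnn.
have mg i : i < size g -> i < maxn w.+1 (size g) by move=> h;
  rewrite leq_max h orbT.
split; rewrite ?szE.
- move=> i j /ltE[li|->] /ltE[lj|->] //; first exact: injf.
    by apply: injw.
  by move/esym/injw => ->.
- move=> i /ltE[/sp//|->]; apply: (@mem_supp _ (f v)); by rewrite adj_sym.
- move=> i; rewrite /add_edge !nbrs_add_dart (negPf nwv).
  by case: (i =P w) => _; [|case: (i =P v) => _];
    rewrite ?rcons_uniq ?nv ?nw un.
move=> i j; rewrite /add_edge !nbrs_add_dart (negPf nwv).
case: (i =P w) => [->|_]; last case: (i =P v) => [->|_].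
- rewrite mem_rcons inE => /orP[/eqP->|/bd[]]; first by rewrite adj_sym;
    split; auto.
  by split; auto.
- rewrite mem_rcons inE => /orP[/eqP->|/bd[]]; first by split; auto.
  by split; auto.
- by case/bd; split; auto.
Qed.

Lemma embeds_eq f f' g : (forall i, i < size g -> f i = f' i) ->
  embeds f g -> embeds f' g.
Proof.
move=> ff' [injf sp un bd]; split=> //.
- by move=> i j li lj; rewrite -!ff' //; apply: injf.
- by move=> i li; rewrite -ff' // sp.
move=> i j /bd[li lj a]; split=> //; by rewrite -!ff'.
Qed.

Lemma size_nbrs_le f g i : embeds f g -> size (nbrs g i) <= 3.
Proof.
move=> emb; have [/(nth_default [::])|li] := leqP (size g) i.
  by rewrite /nbrs => ->.
have [_ sp _ _] := emb.
by rewrite -(nb_embeds_card i emb) -(card_nb (sp i li)) subset_leq_card ?nb_embeds_sub.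
Qed.

Lemma saturated f g i :
  embeds f g -> size (nbrs g i) = 3 -> nb (f i) = [set x in map f (nbrs g i)].
Proof.
move=> emb s3; apply/esym/eqP; rewrite eqEcard nb_embeds_sub //=.
rewrite (nb_embeds_card i emb) s3 card_nb //; have [_ sp _ _] := emb; apply: sp.
by rewrite ltnNge; apply/negP=> /(nth_default [::]); rewrite /nbrs in s3 *;
  move=> h; rewrite h in s3.
Qed.

Lemma unsaturated f g i :
  embeds f g -> i < size g -> size (nbrs g i) < 3 ->
  exists2 y, adj (f i) y & y \notin map f (nbrs g i).
Proof.
move=> emb li s3; have [_ sp _ _] := emb.
have : ~~ (nb (f i) \subset [set x in map f (nbrs g i)]).
  apply/negP=> /subset_leq_card; rewrite nb_embeds_card // card_nb ?sp //.
  by rewrite leqNgt s3.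
case/subsetPn=> y; rewrite !inE => ? ?; by exists y.
Qed.

(** The actual graph steers the recursion: at each candidate [w] it tells whether [f v] and [f w]
    are adjacent, and the branch agreeing with it again satisfies the invariant. Along these
    branches [bad] is only asked about embedded graphs, so the search ends with [false]. *)
Lemma search_sound (bad : seq (seq nat) -> bool) :
  (forall f g, embeds f g -> ~~ bad g) ->
  forall fuel f g v cs, embeds f g -> v < size g ->
    (forall y, adj (f v) y ->
       [\/ y \in map f (nbrs g v), y \in map f cs | y \notin map f (iota 0 (size g))]) ->
    all (gtn (size g)) cs ->
    ~~ search bad fuel v cs g.
Proof.
move=> badP; elim=> [//|fuel IH] f g v cs emb lv missing.
have [injf sp un bd] := emb.
rewrite [search _ _ _ _ _]/=; case: ifP => [s3|/negbT s3].
  case: cs missing => [|w cs] missing.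
    move=> _; have [y vy yn] := unsaturated emb lv s3.
    have [|//|yfresh] := missing y vy; first by rewrite (negPf yn).
    (* Without candidates, the missing neighbour [y] lies outside the image; it becomes the vertex
       [size g]. *)
    pose f' i := if i == size g then y else f i.
    have ff' i : i < size g -> f i = f' i by rewrite /f' => li; rewrite ltn_eqF.
    have fs : f' (size g) = y by rewrite /f' eqxx.
    have emb' : embeds f' g by apply: embeds_eq emb.
    have [_ _ _ bd'] := emb'.
    have gn i : size g \notin nbrs g i by apply/negP=> /bd[_]; rewrite ltnn.
    have nin i : i < size g -> f i != y.
      move=> li; apply: contraNneq yfresh => <-; apply/map_f.
      by rewrite mem_iota.
    have lE : size (add_edge g v (size g)) = (size g).+1.
      by rewrite size_add_edge // (maxn_idPl _).
    apply: (IH f') => //.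
    - apply: embeds_add_edge => //; rewrite ?gtn_eqF ?fs -?ff' //.
      + by apply/negP=> /bd'[]; rewrite ltnn.
      + by move=> i li /eqP; rewrite -ff' // (negPf (nin i li)).
    - by rewrite lE ltnW.
    - move=> z; rewrite -ff' // lE => /missing[zn|//|zfresh].
        apply: Or31; move/mapP: zn => [i iv ->].
        rewrite /add_edge !nbrs_add_dart ltn_eqF // eqxx.
        rewrite ff'; last by case: (bd _ _ iv).
        by apply/map_f; rewrite mem_rcons inE iv orbT.
      case: (z =P y) => [->|/eqP zy].
        apply: Or31; rewrite /add_edge !nbrs_add_dart ltn_eqF // eqxx -fs.
        by apply/map_f; rewrite mem_rcons inE eqxx.
      apply: Or33; apply: contra zfresh => /mapP[i];
        rewrite mem_iota /= add0n ltnS leq_eqVlt.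
      case/orP=> [/eqP->|li]; first by rewrite fs => /eqP; rewrite (negPf zy).
      by rewrite -ff' // => ->; apply/map_f; rewrite mem_iota.
  case/andP=> lw lcs; rewrite [gtn _ _]/= in lw.
  have [/andP[avw wn]|skip] := boolP (adj (f v) (f w) && (w \notin nbrs g v)).
    have wv : w != v by apply: contraTneq avw => ->; rewrite adj_irr.
    case: ifP => // _; rewrite inE negb_or (negPf wv) (negPf wn) /=.
    (* If [w] lists [v] but not conversely, the search gives up with [false]. *)
    case: ifP => // /negbT nv.
    (* A saturated [w] lists all its neighbours, hence also [v], contrary to [nv]. *)
    case: ifP => [s3w|_].
      have sat : nb (f w) = [set x in map f (nbrs g w)].
        by apply: saturated => //; apply/eqP;
          rewrite eqn_leq (size_nbrs_le w emb).
      have : f v \in nb (f w) by rewrite inE adj_sym.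
      rewrite sat inE => /mapP[i iw /injf]; case: (bd _ _ iw) => _ li _.
      by move/(_ lv li) => vi; rewrite vi iw in nv.
    have lE : size (add_edge g v w) = size g.
      by rewrite size_add_edge ?(maxn_idPr _) // ltnW.
    apply: (IH f); rewrite ?lE //.
    - apply: embeds_add_edge => //; first exact: ltnW.
      by move=> i li; apply: injf.
    - move=> y /missing;
        rewrite /add_edge !nbrs_add_dart eq_sym (negPf wv) eqxx.
      rewrite inE map_rcons mem_rcons inE => -[->|/orP[->|->]|->];
        rewrite ?orbT.
      + exact: Or31.
      + exact: Or31.
      + exact: Or32.
      + exact: Or33.
  rewrite ifN //; apply: (IH f) => // y vy.
  case: (missing y vy) => [yn|/=|yn]; [exact: Or31| |exact: Or33].
  rewrite inE => /orP[/eqP yw|yn]; last exact: Or32.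
  move: skip; rewrite -yw vy /= negbK yw => wn; exact/Or31/map_f.
move=> _; rewrite (negPf (badP _ _ emb)).
(* At the next unsaturated vertex all known vertices are candidates, so the invariant on missing
   neighbours is trivial. *)
case: ifP => // lv'; apply: (IH f) => //.
  move=> y _; case: (boolP (y \in map f (iota 0 (size g)))) => yn.
    exact: Or32.
  exact: Or33.
by apply/allP=> i; rewrite mem_iota.
Qed.

(** * Counting adjacent pairs in the ball around an edge *)

Definition closed_nb A := A :|: \bigcup_(x in A) nb x.
Definition edge_ball u v := closed_nb (closed_nb [set u; v]).

Lemma sum_darts_exchange (A B : {set T}) :
  \sum_(x in A) #|nb x :&: B| = \sum_(x in B) #|nb x :&: A|.
Proof.
have E (C D : {set T}) : \sum_(x in C) #|nb x :&: D| =
    \sum_(x in C) \sum_(y in D) adj x y.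
  apply: eq_bigr => x _; rewrite -sum1_card big_mkcond [RHS]big_mkcond /=.
  by apply: eq_bigr => y _; rewrite !inE; case: adj; case: (y \in D).
rewrite !E exchange_big /=; apply: eq_bigr => x _; apply: eq_bigr => y _.
by rewrite adj_sym.
Qed.

(** No edge avoids [A], so each vertex of [supp :\: A] sends all three edges into [A]. The edges
    leaving [A] thus number [3 * #|supp :\: A|], and, seen from [A], [3 * #|A|] minus the inner
    adjacent pairs. *)
Lemma darts_of_dominating (A : {set T}) :
  A \subset supp -> (forall x y, adj x y -> (x \in A) || (y \in A)) ->
  3 * #|supp| + \sum_(x in A) #|nb x :&: A| = 6 * #|A|.
Proof.
move=> As domA.
have split3 : \sum_(x in A) #|nb x :&: A| + \sum_(x in A) #|nb x :&: (supp :\: A)| = 3 * #|A|.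
  rewrite -big_split mulnC -sum_nat_const; apply: eq_bigr => x xA /=.
  rewrite -(card_nb (subsetP As x xA)) -[in RHS](cardsID A (nb x));
    congr (_ + _).
  apply: eq_card => y; rewrite !inE; case: (boolP (adj x y)) => xy;
    rewrite ?andbF //=.
  by rewrite -(@mem_supp y x) ?inE ?andbT // adj_sym.
have out : \sum_(x in A) #|nb x :&: (supp :\: A)| = 3 * #|supp :\: A|.
  rewrite sum_darts_exchange mulnC -sum_nat_const; apply: eq_bigr => x.
  rewrite inE => /andP[xA xs]; rewrite -(card_nb xs); apply: eq_card => y.
  rewrite !inE; case: (boolP (adj x y)) => //= /domA.
  by rewrite (negPf xA).
have := cardsID A supp; rewrite (setIidPr As) => <-.
rewrite mulnDr -out addnAC -[6]/(3 + 3) mulnDl -split3; lia.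
Qed.

(** Each vertex of [B :\: K] has an edge to [K], which counts once from either end. *)
Lemma darts_of_extension (K B : {set T}) :
  K \subset B -> (forall x, x \in B :\: K -> exists2 y, adj x y & y \in K) ->
  \sum_(x in K) #|nb x :&: K| + 2 * #|B :\: K| <= \sum_(x in B) #|nb x :&: B|.
Proof.
move=> KB ext; pose X := B :\: K.
have XK : #|X| <= \sum_(x in X) #|nb x :&: K|.
  rewrite -sum1_card leq_sum // => x /ext[y xy yK].
  by rewrite card_gt0; apply/set0Pn; exists y; rewrite !inE xy.
have KX : \sum_(x in K) #|nb x :&: B|
  = \sum_(x in K) #|nb x :&: K| + \sum_(x in X) #|nb x :&: K|.
  rewrite (sum_darts_exchange X) -big_split; apply: eq_bigr => x _ /=.
  rewrite -(cardsID K (nb x :&: B)) -setIA (setIidPr KB); congr (_ + _).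
  by apply: eq_card => y; rewrite !inE; case: adj; rewrite //= ?andbF.
rewrite [leqRHS](big_setID K) /= (setIidPr KB) KX mul2n -addnn addnA leq_add ?leq_add2l //.
apply: leq_trans XK _; apply: leq_sum => x _.
by rewrite subset_leq_card // setIS.
Qed.

(** This is the form in which the bound on the diameter of the line graph enters. *)
Hypothesis dominating : forall u v x y, adj u v -> adj x y ->
  (x \in edge_ball u v) || (y \in edge_ball u v).

Lemma card_cover_seq (I : eqType) (s : seq I) (F : I -> {set T}) (X : {set T}) :
  (forall x, x \in X -> exists2 i, i \in s & x \in F i) ->
  #|X| <= \sum_(i <- s) #|F i|.
Proof.
elim: s X => [|i s IH] X XF.
  by rewrite big_nil leqn0 cards_eq0; apply/set0Pn=> -[x /XF[]].
rewrite big_cons -(cardsID (F i)) leq_add ?subset_leq_card ?subsetIr //.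
apply: IH => x; rewrite inE => /andP[xi /XF[j]];
  rewrite inE => /orP[/eqP->|js xj].
  by rewrite (negPf xi).
by exists j.
Qed.

Lemma mem_ball g s j :
  reflect (j \in s \/ exists2 i, i \in s & j \in nbrs g i) (j \in ball g s).
Proof.
rewrite mem_undup mem_cat; apply: (iffP orP) => -[]; auto.
  by case/flatten_mapP=> i; right; exists i.
by case=> i ? ?; right; apply/flatten_mapP; exists i.
Qed.

Lemma crowded_edge_sound f g u v :
  embeds f g -> v \in nbrs g u -> ~~ crowded_edge #|supp| g u v.
Proof.
move=> emb uv; rewrite /crowded_edge; case: ifP => // /andP[/eqP su /eqP sv].
set b1 := ball g [:: u; v]; set b2 := ball g b1; rewrite -leqNgt.
have [injf sp un bd] := emb.
have [lu lv auv] := bd _ _ uv.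
have lt_ball s : all (gtn (size g)) s -> all (gtn (size g)) (ball g s).
  move=> ls; apply/allP=> j /mem_ball[|[i _ /bd[_]//]]; exact: (allP ls).
have l1 : all (gtn (size g)) b1 by apply: lt_ball; rewrite /= lu lv.
have l2 : all (gtn (size g)) b2 by apply: lt_ball.
have inj2 : {in b2 &, injective f}.
  by move=> i j /(allP l2) li /(allP l2) lj; apply: injf.
pose K := [set x in map f b2].
have cK : #|K| = size b2.
  by rewrite cardsE (card_uniqP _) ?size_map // map_inj_in_uniq // undup_uniq.
pose B := edge_ball (f u) (f v).
(* As [u] and [v] are saturated, the ball of radius 1 is completely known; vertices can be missing
   only at distance 2. *)
have B1E : closed_nb [set f u; f v] = [set x in map f b1].
  have sat i : i \in [:: u; v] -> nb (f i) = [set x in map f (nbrs g i)].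
    by rewrite !inE => /orP[] /eqP->; apply: saturated.
  apply/setP=> x;
    rewrite in_setU bigcup_setU !big_set1 !sat ?inE ?eqxx ?orbT //.
  apply/idP/mapP.
    rewrite -orbA => /or4P[/eqP->|/eqP->|/mapP[j ju ->]|/mapP[j ju ->]].
    - by exists u => //; apply/mem_ball; left; rewrite inE eqxx.
    - by exists v => //; apply/mem_ball; left; rewrite !inE eqxx orbT.
    - by exists j => //; apply/mem_ball; right; exists u; rewrite // !inE eqxx.
    - by exists j => //; apply/mem_ball; right; exists v;
        rewrite // !inE eqxx orbT.
  case=> j /mem_ball[|[i]]; rewrite !inE.
    by case/orP=> /eqP-> ->; rewrite eqxx ?orbT.
  by case/orP=> /eqP-> ji ->; rewrite (map_f f ji) ?orbT.
have KB : K \subset B.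
  apply/subsetP=> x; rewrite inE => /mapP[j /mem_ball jb ->].
  rewrite /B /edge_ball B1E inE; case: jb => [jb|[i ib ji]];
    first by rewrite inE map_f.
  apply/orP; right; apply/bigcupP; exists (f i); first by rewrite inE map_f.
  by rewrite inE; case: (bd _ _ ji).
have XE x : x \in B :\: K ->
  exists2 i, i \in b1 & x \in nb (f i) :\: [set y in map f (nbrs g i)].
  rewrite inE => /andP[xK]; rewrite /B /edge_ball inE B1E => /orP[|].
    rewrite inE => /mapP[i ib xE]; case/negP: xK; rewrite inE xE map_f //.
    by apply/mem_ball; left.
  case/bigcupP=> y; rewrite inE => /mapP[i ib ->] xi; exists i => //.
  rewrite inE xi andbT; apply: contra xK; rewrite !inE => /mapP[j ji ->].
  by apply/map_f/mem_ball; right; exists i.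
have cX : #|B :\: K| <= deficit g b1.
  apply: leq_trans (card_cover_seq XE) _.
  rewrite /deficit sumnE big_map big_seq [leqRHS]big_seq;
    apply: leq_sum => i /(allP l1) li.
  by rewrite cardsD (setIidPr (nb_embeds_sub i emb)) nb_embeds_card // card_nb ?sp.
have nbs (A : {set T}) : A \subset supp -> closed_nb A \subset supp.
  move=> As; rewrite subUset As; apply/bigcupsP=> x _; apply/subsetP=> y.
  by rewrite inE adj_sym => /mem_supp.
have Bs : B \subset supp.
  by apply/nbs/nbs; rewrite subUset !sub1set !sp.
have := darts_of_dominating Bs (fun x y => @dominating _ _ x y auv).
have : \sum_(x in K) #|nb x :&: K| + 2 * #|B :\: K|
  <= \sum_(x in B) #|nb x :&: B|.
  apply: darts_of_extension => // x /XE[i ib]; rewrite in_setD => /andP[_];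
    rewrite inE => ix.
  exists (f i); first by rewrite adj_sym.
  by rewrite inE map_f //; apply/mem_ball; left.
(* Only an inequality: vertices of [K] may be adjacent without this being recorded in [g]. *)
have : darts g b2 <= \sum_(x in K) #|nb x :&: K|.
  rewrite /darts sumnE big_map.
  have -> : \sum_(x in K) #|nb x :&: K| = \sum_(x <- map f b2) #|nb x :&: K|.
    rewrite big_uniq ?map_inj_in_uniq ?undup_uniq //=.
    by apply: eq_bigl => x; rewrite inE.
  rewrite big_map; apply: leq_sum => i _.
  rewrite -size_filter -(size_map f) -(card_uniqP _); last first.
    rewrite map_inj_in_uniq ?filter_uniq // => j k; rewrite !mem_filter.
    by case/andP=> jb _ /andP[kb _]; apply: inj2.
  apply/subset_leq_card/subsetP=> x /mapP[j];
    rewrite mem_filter => /andP[jb ji] ->.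
  by rewrite !inE map_f // andbT; case: (bd _ _ ji).
have := cardsID K B; rewrite (setIidPr KB) cK; lia.
Qed.

Lemma size_embeds f g : embeds f g -> size g <= #|supp|.
Proof.
move=> emb; have [injf sp un bd] := emb.
rewrite -(size_iota 0 (size g)) -(size_map f) -(card_uniqP _); last first.
  rewrite map_inj_in_uniq ?iota_uniq // => i j; rewrite !mem_iota; exact: injf.
by apply/subset_leq_card/subsetP=> x /mapP[i]; rewrite mem_iota => /sp ? ->.
Qed.

Lemma crowded_sound f g : embeds f g -> ~~ crowded #|supp| g.
Proof.
move=> emb; have [injf sp un bd] := emb.
apply/norP; split; first by rewrite -leqNgt (size_embeds emb).
apply/hasPn=> u _; apply/hasPn=> v uv; case: ifP => // _.
exact: crowded_edge_sound emb uv.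
Qed.

(** * Excluding short cycles, then cubic graphs of order 16 or 18 *)

Lemma cycle_from_sound f g m x p :
  embeds f g -> uniq (x :: p) -> all (gtn (size g)) (x :: p) ->
  path adj (f x) (map f p) -> cycle_from g m (x :: p) ->
  exists2 c : seq T, 2 < size c <= m + (size p).+1 & uniq c && cycle adj c.
Proof.
move=> emb; have [injf _ _ bd] := emb.
elim: m x p => [|m IH] x p un lt pth /=; rewrite ?orbF.
  case/andP=> sz lx; exists (map f (x :: p));
    first by rewrite size_map sz add0n leqnn.
  rewrite map_inj_in_uniq ?un //=;
    last by move=> i j /(allP lt) li /(allP lt) lj; apply: injf.
  by rewrite rcons_path pth last_map adj_sym /=; case: (bd _ _ lx).
case/orP.
  case/andP=> sz lx; exists (map f (x :: p));
    first by rewrite size_map sz leq_addl.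
  rewrite map_inj_in_uniq ?un //=;
    last by move=> i j /(allP lt) li /(allP lt) lj; apply: injf.
  by rewrite rcons_path pth last_map adj_sym /=; case: (bd _ _ lx).
case/hasP=> y yx; case: ifP => // /negbT yp; have [_ ly axy] := bd _ _ yx.
move=> /IH[]; first by rewrite [uniq _]/= yp.
- by rewrite [all _ _]/= ly.
- by rewrite /= adj_sym axy.
by move=> c; rewrite addSnnS; exists c.
Qed.

Definition short_cycle c := [&& 2 < size c <= 6, uniq c & cycle adj c].

Lemma cyclic_sound f g :
  #|supp| <= 18 -> (forall c, ~~ short_cycle c) -> embeds f g -> ~~ cyclic g.
Proof.
move=> n18 nocyc emb; apply/norP; split.
  by rewrite -leqNgt (leq_trans (size_embeds emb)).
apply/hasPn=> v; rewrite mem_iota => lv; apply/negP=> cv.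
have [| | |c sz un] := cycle_from_sound emb _ _ _ cv; rewrite //=.
  by rewrite andbT; apply: lv.
by have := nocyc c; rewrite /short_cycle sz un.
Qed.

Lemma short_cycle_embeds c : short_cycle c ->
  exists f, embeds f (cycle_graph (size c)).
Proof.
case/and3P=> sz un cy.
have [x0 xc] : exists x0, x0 \in c by case: c sz {un cy} => // x c; exists x;
  rewrite mem_head.
have adjc i : i < size c -> adj (nth x0 c i) (nth x0 c (i.+1 %% size c)).
  move=> li; have := next_cycle cy (mem_nth x0 li); rewrite next_nth mem_nth //.
  case: c {sz xc} un cy li => // y c un cy li; rewrite index_uniq //.
  move: li; rewrite [size _]/= ltnS leq_eqVlt => /orP[/eqP->|li].
    by rewrite modnn [nth y c _]nth_default.
  by rewrite modn_small // (set_nth_default x0).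
have nbE i : nbrs (cycle_graph (size c)) i =
    if i < size c then [:: i.+1 %% size c;
      (i + (size c).-1) %% size c] else [::].
  case: ifP => li; first by rewrite /nbrs nth_mkseq.
  by rewrite /nbrs nth_default // size_mkseq leqNgt li.
have c0 : 0 < size c by case: (size c) sz.
exists (nth x0 c); split; rewrite ?size_mkseq.
- by move=> i j li lj /eqP; rewrite nth_uniq // => /eqP.
- by move=> i /adjc/mem_supp.
- move=> i; rewrite nbE; case: ifP => //= li; rewrite andbT inE.
  have -> : i.+1 %% size c = if i.+1 == size c then 0 else i.+1.
    by case: eqP => [->|/eqP ne];
      [exact: modnn|rewrite modn_small // ltn_neqAle ne].
  have -> : (i + (size c).-1) %% size c
    = if i is i'.+1 then i' else (size c).-1.
    case: i li => [|i] li; first by rewrite modn_small // prednK.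
    by rewrite addSnnS prednK // modnDr modn_small // ltnW.
  (* The successor and the predecessor on a cycle differ because its length is at least 3. *)
  by apply/eqP; move: sz li; case: i => [|i]; move: (size c) => k;
    case: ifP => /eqP; lia.
move=> i j; rewrite nbE; case: ifP => // li;
  rewrite !inE => /orP[/eqP->|/eqP->].
  by rewrite ltn_pmod // adjc.
rewrite ltn_pmod //; split=> //; rewrite adj_sym.
have := adjc _ (ltn_pmod (i + (size c).-1) c0).
suff -> : ((i + (size c).-1) %% size c).+1 %% size c = i by [].
by rewrite -addn1 modnDml -addnA addn1 prednK // modnDr modn_small.
Qed.

Lemma refuted_sound (bad : seq (seq nat) -> bool) f g :
  (forall f g, embeds f g -> ~~ bad g) -> 0 < size g ->
  refuted bad g -> ~ embeds f g.
Proof.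
move=> badP g0 r emb; move: r; apply/negP.
apply: (search_sound badP 400 emb g0).
  move=> y _; case: (boolP (y \in map f (iota 0 (size g)))) => yn.
    exact: Or32.
  exact: Or33.
by apply/allP=> i; rewrite mem_iota.
Qed.

Lemma no_short_cycle c : #|supp| \in [:: 16; 18] -> ~~ short_cycle c.
Proof.
move=> n; apply/negP=> sc; have [f emb] := short_cycle_embeds sc.
have /and3P[sz _ _] := sc.
have k : size c \in [:: 3; 4; 5; 6] by rewrite !inE; lia.
have g0 : 0 < size (cycle_graph (size c)) by rewrite size_mkseq;
  case: (size c) sz.
exact: (refuted_sound crowded_sound g0 (refuted_crowded n k) emb).
Qed.

(** Any edge embeds the one-edge start, and without short cycles no embedded graph is [cyclic]. *)
Lemma no_cubic x y : #|supp| \in [:: 16; 18] -> ~~ adj x y.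
Proof.
move=> n; apply/negP=> xy; pose f i := if i == 0 then x else y.
have xNy : x <> y by move=> e; rewrite e adj_irr in xy.
have cycP h g : embeds h g -> ~~ cyclic g.
  apply: cyclic_sound => [|c]; last exact: no_short_cycle.
  by move: n; rewrite !inE; lia.
suff emb : embeds f [:: [:: 1]; [:: 0]].
  by apply: (refuted_sound cycP _ refuted_cyclic emb).
have xs := mem_supp xy; have ys : y \in supp by apply: (@mem_supp y x);
  rewrite adj_sym.
split=> //.
- by case=> [|[|i]] [|[|j]] //= _ _ e; case: xNy.
- by case=> [|[|i]].
- by case=> [|[|i]] //; rewrite /nbrs nth_default.
case=> [|[|i]] j; rewrite /nbrs /= ?nth_nil // inE => /eqP->; split=> //.
by rewrite adj_sym.
Qed.

End Cubic.

(** * From a line graph of diameter at most 3 to a cubic graph *)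

Lemma enat_le_bigP n (I : finType) (H : I -> enat) :
  reflect (forall i, enat_le (H i) n) (enat_le (\big[enat_max/Some 0]_i H i) n).
Proof.
have E : {morph (enat_le^~ n) : a b / enat_max a b >-> a && b}.
  by case=> [a|] [b|] //=; rewrite ?geq_max ?andbF.
rewrite (big_morph (enat_le^~ n) E (id1 := true)) // big_andE.
exact: forallP.
Qed.

Section Multigraph.

Variable G : mgraph.
Implicit Types (e f : edge G) (v : vertex G) (F : {set edge G}).

Definition inc v := [set e | v \in ends e].
Definition cover_ends F := \bigcup_(e in F) ends e.
(** The closed neighbourhood of [F] in the line graph. *)
Definition enbrs F := [set f | ends f :&: cover_ends F != set0].

Hypothesis deg3 : forall v, degree v <= 3.

Lemma card_inc v : #|inc v| <= 3.
Proof.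
apply: leq_trans (deg3 v); rewrite -sum1dep_card; apply: leq_sum => e _.
by case: ifP.
Qed.

Lemma enbrsP F f :
  reflect (exists2 w, w \in ends f & exists2 e, e \in F & w \in ends e) (f \in enbrs F).
Proof.
rewrite inE; apply: (iffP (set0Pn _)) => [[w]|[w wf [e eF we]]].
  by rewrite inE => /andP[wf /bigcupP[e eF we]]; exists w => //; exists e.
by exists w; rewrite inE wf; apply/bigcupP; exists e.
Qed.

Lemma ends_neq0 e : exists v, v \in ends e.
Proof. by apply/set0Pn; rewrite -card_gt0; case/andP: (card_ends e). Qed.

Lemma sub_enbrs F : F \subset enbrs F.
Proof.
apply/subsetP=> e eF; have [v ve] := ends_neq0 e.
by apply/enbrsP; exists v => //; exists e.
Qed.

(** An edge of [enbrs F :\: F] already has an end covered by [F]. New edges can attach only at its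
    other end, where at most two further edges fit. *)
Lemma growth F : #|enbrs (enbrs F) :\: enbrs F| <= 2 * #|enbrs F :\: F|.
Proof.
pose X g := \bigcup_(w in ends g :\: cover_ends F) (inc w :\ g).
have XE f : f \in enbrs (enbrs F) :\: enbrs F ->
  exists2 g, g \in enum (enbrs F :\: F) & f \in X g.
  rewrite inE => /andP[fn /enbrsP[w wf [g gF wg]]]; exists g.
    rewrite mem_enum inE gF andbT; apply: contra fn => gF'.
    by apply/enbrsP; exists w => //; exists g.
  apply/bigcupP; exists w; rewrite !inE ?wf ?wg andbT.
    apply: contra fn => /bigcupP[e eF we]; apply/enbrsP; exists w => //;
      by exists e.
  by apply: contraNneq fn => ->.
apply: leq_trans (card_cover_seq XE) _.
rewrite big_enum /= mulnC -sum_nat_const; apply: leq_sum => g;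
  rewrite inE => /andP[_ /enbrsP[z zg [e eF ze]]].
have zF : z \in cover_ends F by apply/bigcupP; exists e.
have : #|ends g :\: cover_ends F| <= 1.
  have /andP[_] := card_ends g; rewrite -(cardsID (cover_ends F) (ends g)).
  have : 0 < #|ends g :&: cover_ends F|.
    by rewrite card_gt0; apply/set0Pn; exists z; rewrite inE zg.
  lia.
rewrite leq_eqVlt ltnS leqn0 cards_eq0 /X => /orP[/cards1P[w we]|/eqP->];
  last first.
  by rewrite big_set0 cards0.
rewrite we big_set1; have /setP/(_ w) := we; rewrite !inE eqxx => /andP[_ wg].
by have := card_inc w; rewrite (cardsD1 g) inE wg.
Qed.

Hypothesis diam3 : enat_le (diam (line_graph (G := G))) 3.

Lemma path_enbrs F e p :
  e \in F -> path (line_graph (G := G)) e p ->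
    last e p \in iter (size p) enbrs F.
Proof.
elim: p e F => [//|f p IH] e F eF /= /andP[/andP[_ /set0Pn[v]]];
  rewrite inE => /andP[ve vf] pth.
rewrite -iterS iterSr; apply: IH pth.
by apply/enbrsP; exists v => //; exists e.
Qed.

Lemma within3 e f : f \in enbrs (enbrs (enbrs [set e])).
Proof.
have /enat_le_bigP/(_ e)/enat_le_bigP/(_ f) := diam3.
rewrite /dist; case: decP => // ef;
  case: ex_minnP => k /existsP[p /andP[pth /eqP <-]] _ /= k3.
have sub i F : F \subset iter i enbrs F.
  elim: i => [|i IH]; first exact: subxx.
  by rewrite iterS (subset_trans IH) ?sub_enbrs.
(* The distance [k] may be below 3; the remaining [3 - k] rounds only enlarge the set. *)
rewrite -[enbrs (enbrs _)]/(iter 3 enbrs [set e]) -(subnK k3) iterD.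
apply: (subsetP (sub _ _)); have := path_enbrs (set11 e) pth.
by rewrite size_tuple.
Qed.

(** With [a = #|enbrs [set e]|], at most [a - 1], [2 * (a - 1)] and [4 * (a - 1)] edges lie at
    distance 1, 2 and 3 from [e]; with [e] itself this makes [7 * a - 6]. *)
Lemma num_edges_le e : num_edges G + 6 <= 7 * #|enbrs [set e]|.
Proof.
have -> : num_edges G = #|enbrs (enbrs (enbrs [set e]))|.
  by apply/eq_card=> f; rewrite within3.
have D F := cardsID F (enbrs F); have S F := setIidPr (sub_enbrs F).
have := growth [set e]; have := growth (enbrs [set e]).
have := D [set e]; have := D (enbrs [set e]); have := D (enbrs (enbrs [set e])).
rewrite !S cards1; lia.
Qed.

Hypothesis edges23 : 23 <= num_edges G.

Lemma card_enbrs1 e : 4 < #|enbrs [set e]|.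
Proof. by have := num_edges_le e; lia. Qed.

Lemma enbrs1 e : enbrs [set e] = \bigcup_(v in ends e) inc v.
Proof.
apply/setP=> f; apply/enbrsP/bigcupP => [[w wf [g /set1P-> we]]|[w we]].
  by exists w; rewrite // inE.
by rewrite inE => wf; exists w => //; exists e; rewrite // set11.
Qed.

(** At least 5 edges lie in the closed neighbourhood of [e]. A loop allows only 3, and two ends
    allow [3 + 3 - 1]; equality forces degree 3 at both ends and excludes edges parallel to [e]. *)
Lemma ends_pair e : exists u v,
  [/\ u != v, ends e = [set u; v], forall w, w \in ends e -> #|inc w| = 3,
      inc u :&: inc v = [set e] & #|enbrs [set e]| = 5].
Proof.
have a5 := card_enbrs1 e; rewrite enbrs1 in a5 *.
have /andP[] := card_ends e;
  rewrite leq_eqVlt eq_sym => /orP[/cards1P[u E] _|lo hi].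
  by move: a5; rewrite E big_set1; have := card_inc u; lia.
have /eqP/cards2P[u [v [uv E]]] : #|ends e| = 2 by lia.
exists u, v; move: a5; rewrite E bigcup_setU !big_set1 cardsU.
have := card_inc u; have := card_inc v.
have eI : e \in inc u :&: inc v by rewrite !inE E !inE !eqxx orbT.
have : 0 < #|inc u :&: inc v| by rewrite card_gt0; apply/set0Pn; exists e.
move=> h1 h2 h3 h4; split=> //; try lia.
  by move=> w; rewrite !inE => /orP[]/eqP->; lia.
have /eqP/cards1P[f If] : #|inc u :&: inc v| = 1 by lia.
by move: eI; rewrite If => /set1P->.
Qed.

Definition adjacent : rel (vertex G) :=
  fun x y => (x != y) && [exists e, (x \in ends e) && (y \in ends e)].

Lemma adjacent_sym : symmetric adjacent.
Proof.
by move=> x y; rewrite /adjacent eq_sym; congr (_ && _);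
  apply: eq_existsb => e; rewrite andbC.
Qed.

Lemma adjacent_irr : irreflexive adjacent.
Proof. by move=> x; rewrite /adjacent eqxx. Qed.

Lemma adjacent_ends x y e : x != y -> x \in ends e -> y \in ends e -> ends e
  = [set x; y].
Proof.
move=> xy xe ye; apply/esym/eqP;
  rewrite eqEcard subUset !sub1set xe ye cards2 xy /=.
by case/andP: (card_ends e).
Qed.

Lemma adjacent_unique x y e f : x != y ->
  x \in ends e -> y \in ends e -> x \in ends f -> y \in ends f -> e = f.
Proof.
move=> xy xe ye xf yf; have [u [v [uv E _ I _]]] := ends_pair e.
have Ef : ends f
  = ends e by rewrite (adjacent_ends xy xe ye) (adjacent_ends xy xf yf).
have : f \in inc u :&: inc v by rewrite !inE Ef E !inE !eqxx orbT.
by rewrite I => /set1P.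
Qed.

Lemma card_inc_ends x e : x \in ends e -> #|inc x| = 3.
Proof. by have [u [v [_ _ inc3 _ _]]] := ends_pair e; apply: inc3. Qed.

Lemma other_end x e : x \in ends e -> exists2 y, y != x & y \in ends e.
Proof.
have [u [v [uv -> _ _ _]]] := ends_pair e.
rewrite !inE => /orP[]/eqP->; [exists v|exists u]; rewrite ?inE ?eqxx ?orbT //.
by rewrite eq_sym.
Qed.

Lemma card_adjacent x : #|nb adjacent x| = #|inc x|.
Proof.
(* The other end of [e]; the default [x] does not occur for edges at [x], since there are no
   loops. *)
pose h e := odflt x [pick y in ends e :\ x].
have hP e : e \in inc x -> h e != x /\ h e \in ends e.
  rewrite inE => /other_end[y yx ye]; rewrite /h; case: pickP => [z|/(_ y)] /=.
    by rewrite !inE => /andP[].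
  by rewrite !inE yx ye.
have <- : h @: inc x = nb adjacent x.
  apply/setP=> y; rewrite inE; apply/imsetP/andP => [[e ex ->]|].
    have [hx he] := hP e ex; split; first by rewrite eq_sym.
    by apply/existsP; exists e; rewrite he andbT; rewrite inE in ex.
  case=> xy /existsP[e /andP[xe ye]]; exists e; rewrite ?inE //.
  have [|hx he] := hP e; first by rewrite inE.
  move: he; rewrite (adjacent_ends xy xe ye) !inE (negPf hx) /= => /eqP.
  by move->.
apply: card_in_imset => e f ei fi hef.
have [hx he] := hP e ei; have [_ hf] := hP f fi; rewrite -hef in hf.
by rewrite !inE in ei fi; apply: (@adjacent_unique (h e) x).
Qed.

Lemma adjacent_cubic x y : adjacent x y -> #|nb adjacent x| = 3.
Proof.
by case/andP=> _ /existsP[e /andP[xe _]];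
  rewrite card_adjacent (card_inc_ends xe).
Qed.

(** The handshake count; a vertex outside [supp] has no edges, because an edge there would have
    another end. *)
Lemma card_supp : 3 * #|supp adjacent| = 2 * num_edges G.
Proof.
have -> : 3 * #|supp adjacent| = \sum_x #|inc x|.
  rewrite mulnC -sum_nat_const [RHS](bigID (mem (supp adjacent))) /= [X in _ + X]big1 ?addn0.
    by apply: eq_bigr => x; rewrite inE => /existsP[y /adjacent_cubic];
      rewrite card_adjacent.
  move=> x; rewrite inE; apply: contraNeq; rewrite -lt0n card_gt0 => /set0Pn[e].
  rewrite inE => xe; have [y yx ye] := other_end xe; apply/existsP; exists y.
  by rewrite /adjacent eq_sym yx; apply/existsP; exists e; rewrite xe.
have -> : 2 * num_edges G = \sum_(e : edge G) #|ends e|.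
  rewrite mulnC -sum_nat_const; apply: eq_bigr => e _.
  by have [u [v [uv -> _ _ _]]] := ends_pair e; rewrite cards2 uv.
rewrite (eq_bigr (fun x => \sum_(e : edge G) (x \in ends e))); last first.
  by move=> x _; rewrite -sum1dep_card big_mkcond; apply: eq_bigr => e _;
    case: ifP.
rewrite exchange_big; apply: eq_bigr => e _.
by rewrite -sum1_card [RHS]big_mkcond; apply: eq_bigr => x _; case: ifP.
Qed.

Lemma cover_ends_enbrs F (A : {set vertex G}) : cover_ends F \subset A ->
  cover_ends (enbrs F) \subset closed_nb adjacent A.
Proof.
move=> FA; apply/subsetP=> w /bigcupP[g /enbrsP[z zg [e eF ze]] wg].
have zA : z \in A by apply: (subsetP FA); apply/bigcupP; exists e.
rewrite inE; case: (z =P w) => [<-|/eqP zw]; first by rewrite zA.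
apply/orP; right; apply/bigcupP; exists z => //.
by rewrite inE /adjacent zw; apply/existsP; exists g; rewrite zg.
Qed.

Lemma adjacent_dominating u v x y : adjacent u v -> adjacent x y ->
  (x \in edge_ball adjacent u v) || (y \in edge_ball adjacent u v).
Proof.
case/andP=> uv /existsP[e /andP[ue ve]] /andP[xy /existsP[f /andP[xf yf]]].
(* [f] meets an edge [g] reached from [e] in two rounds, and the ends of [g] lie in the ball of
   radius 2. *)
have /enbrsP[w wf [g gN wg]] := within3 e f.
have wB : w \in edge_ball adjacent u v.
  apply: (subsetP (cover_ends_enbrs (cover_ends_enbrs _))); last first.
    by apply/bigcupP; exists g; first exact: gN.
  by rewrite /cover_ends big_set1 (adjacent_ends uv ue ve).
by move: wf; rewrite (adjacent_ends xy xf yf) in_set2 => /orP[]/eqP<-;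
  rewrite wB ?orbT.
Qed.

Lemma too_many_edges : False.
Proof.
have [e _] : exists e : edge G, true.
  case: (pickP (@predT (edge G))) => [e _|none]; first by exists e.
  by have := eq_card0 none; rewrite -/(num_edges G); lia.
have [u [v [uv E _ _ c5]]] := ends_pair e.
have := num_edges_le e; rewrite c5 => le29.
(* From [3 * n = 2 * m] and [23 <= m <= 29] it follows that [m] is 24 or 27. *)
have n : #|supp adjacent| \in [:: 16; 18] by have := card_supp; rewrite !inE;
  lia.
have := no_cubic adjacent_sym adjacent_irr adjacent_cubic adjacent_dominating u v n.
by rewrite /adjacent uv; case/existsP; exists e; rewrite E !inE !eqxx orbT.
Qed.

End Multigraph.

Lemma num_edges_le22 (G : mgraph) :
  max_degree G <= 3 -> enat_le (diam (line_graph (G := G))) 3 -> num_edges G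
    <= 22.
Proof.
move=> /bigmax_leqP deg3 diam3; rewrite leqNgt; apply/negP.
by apply: too_many_edges => // v; apply: deg3.
Qed.

(** * A simple graph with 22 edges attaining the bound *)

(* Vertex 0 has degree 2 and the 22 edges form the largest possible ball around
   the edge 01: a tree on the vertices 0 to 10, whose 6 leaves are joined to
   the vertices 11 to 14. *)
Definition extremal_edges := [:: (0,1); (0,2); (1,3); (1,4); (2,5); (2,6);
  (3,7); (3,8); (4,9); (4,10); (5,11); (7,11); (9,11); (5,12); (8,12); (10,12);
  (6,13); (7,13); (10,13); (6,14); (8,14); (9,14)].

(** Incidence on plain numbers lets [vm_compute] settle the finite checks; [mem_extremal_ends]
    transfers them to [extremal]. *)
Definition end1 i := (nth (0, 0) extremal_edges i).1.
Definition end2 i := (nth (0, 0) extremal_edges i).2.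
Definition incident i k := (k == end1 i) || (k == end2 i).
Definition meeting i :=
  [seq j <- iota 0 22 | (i != j) && (incident j (end1 i) || incident j (end2 i))].

Fixpoint reach n i j :=
  (i == j) || (if n is n'.+1 then has (fun k => reach n' k j) (meeting i) else false).

Lemma extremal_card_ends (i : 'I_22) :
  0 < #|[set inord (end1 i); inord (end2 i) : 'I_15]| <= 2.
Proof. by rewrite cards2; case: eqP. Qed.

Definition extremal := MGraph extremal_card_ends.

Lemma all_iotaP n (P : pred nat) : all P (iota 0 n) -> forall i : 'I_n, P i.
Proof. by move/allP=> h i; apply: h; rewrite mem_iota ltn_ord. Qed.

Lemma end12_lt (i : 'I_22) : end1 i < end2 i < 15.
Proof.
have lt : all (fun i => end1 i < end2 i < 15) (iota 0 22) by vm_compute.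
exact: all_iotaP lt i.
Qed.

Lemma mem_extremal_ends (e : edge extremal) (v : vertex extremal) :
  (v \in ends e) = incident (e : 'I_22) (v : 'I_15).
Proof.
have /andP[lt12 lt2] := end12_lt e.
by rewrite !inE -!val_eqE /= !inordK // (ltn_trans lt12).
Qed.

Lemma extremal_loopless (e : edge extremal) : ~~ is_loop e.
Proof.
have /andP[lt12 lt2] := end12_lt e; have lt1 := ltn_trans lt12 lt2.
rewrite /is_loop cards2 -val_eqE /= !inordK //.
by rewrite (ltn_eqF lt12).
Qed.

Lemma extremal_simple : simple extremal.
Proof.
split; first exact: extremal_loopless.
move=> e f /setP eq_ends; apply/val_inj/eqP; move: e f eq_ends => i j eq_ends.
pose separated i j :=
  (i == j) || has (fun k => incident i k != incident j k) (iota 0 15).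
have sep : all (fun i => all (separated i) (iota 0 22)) (iota 0 22) by vm_compute.
case/orP: (all_iotaP (all_iotaP sep i) j) => // /hasP[k];
  rewrite mem_iota => /andP[_ lk].
by have := eq_ends (Ordinal lk); rewrite !mem_extremal_ends /= => ->;
  rewrite eqxx.
Qed.

Lemma extremal_max_degree : max_degree extremal <= 3.
Proof.
apply/bigmax_leqP=> v _; rewrite /degree.
rewrite (eq_bigr (fun=> 1)); last by move=> e _;
  rewrite (negPf (extremal_loopless e)).
rewrite (eq_bigl (fun e : 'I_22 => incident e (v : 'I_15))); last first.
  by move=> e; rewrite mem_extremal_ends.
rewrite -(big_mkord (fun i => incident i (v : 'I_15)) (fun=> 1)) sum1_count.
have deg : all (fun k => count (incident^~ k) (index_iota 0 22)
  <= 3) (iota 0 15).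
  by vm_compute.
exact: all_iotaP deg v.
Qed.

Lemma reach_path n (e f : edge extremal) : reach n (e : 'I_22) (f : 'I_22) ->
  exists p, [/\ path (line_graph (G := extremal)) e p, last e p = f & size p
    <= n].
Proof.
elim: n e => [|n IH] e /= /orP[/eqP/val_inj->|] //; try by exists [::].
case/hasP=> k;
  rewrite mem_filter mem_iota => /andP[/andP[ek kmeet] /andP[_ lk]].
case/(IH (Ordinal lk)) => p [pth lst sz]; exists (Ordinal lk :: p); split=> //=.
rewrite pth andbT /line_graph -val_eqE ek; apply/set0Pn.
have /andP[lt12 lt2] := end12_lt e; have lt1 := ltn_trans lt12 lt2.
case/orP: kmeet => inck; [exists (Ordinal lt1)|exists (Ordinal lt2)];
  by rewrite inE !mem_extremal_ends inck andbT /incident eqxx ?orbT.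
Qed.

Lemma enat_le_dist (T : finType) (adj : rel T) x p :
  path adj x p -> enat_le (dist adj x (last x p)) (size p).
Proof.
move=> pth; rewrite /dist; case: decP => [xy|[]]; last by apply/connectP;
  exists p.
case: ex_minnP => m _; apply; apply/existsP; exists (in_tuple p).
by rewrite pth eqxx.
Qed.

Lemma enat_le_trans d m n : enat_le d m -> m <= n -> enat_le d n.
Proof. by case: d => //= d; apply: leq_trans. Qed.

Lemma extremal_diam : enat_le (diam (line_graph (G := extremal))) 3.
Proof.
apply/enat_le_bigP=> e; apply/enat_le_bigP=> f.
have reach3 : all (fun i => all (reach 3 i) (iota 0 22)) (iota 0 22) by vm_compute.
case/reach_path: (all_iotaP (all_iotaP reach3 e) f) => p [pth <- sz].
exact: enat_le_trans (enat_le_dist pth) sz.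
Qed.

Theorem theorem2 :
  (forall G : mgraph,
      max_degree G = 3 -> 23 <= num_edges G ->
      enat_gt (diam (line_graph (G := G))) 3)
  /\ is_h 3 3 23.
Proof.
split=> [G deg3 edges23|].
  have := @num_edges_le22 G; rewrite deg3 => /(_ isT).
  (* An infinite diameter exceeds 3 by the definition of [enat_gt]. *)
  case: diam => //= d small; rewrite ltnNge; apply/negP=> /small.
  by rewrite leqNgt edges23.
exists 22; split=> //.
  exists extremal; last exact: card_ord.
  by split; [exact: extremal_simple|exact: extremal_max_degree|exact: extremal_diam].
by move=> G [_]; apply: num_edges_le22.
Qed.
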